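(* Let $F_u(G,\Delta)$ be the uncertain system with actuator uncertainty $\dot x_G=f(x_G,w,d)+g(x_G,w,d)u$, $v=h(x_G,w,d,u)$, $w=\Delta(v)$ on $[0,T]$, and let $F,H$ be the maps of the extended system with state $x=[x_G;x_\psi]\in\mathbb{R}^n$, $n=n_G+n_\psi$, as defined in the context. Let $T>0$, $R>0$, $\gamma\in\mathbb{R}$, $X_T\subset\mathbb{R}^{n_G}$, $P\in\mathbb{R}^{n_p\times n_u}$, $b\in\mathbb{R}^{n_p}$ be given, with control constraint set $U=\{u\in\mathbb{R}^{n_u}:Pu\le b\}$, and let the disturbances satisfy $\|d\|_{2,[0,T]}<R$. Let $\Psi$ and $M\in\mathbb{S}^{n_z}$ be given and assume that $\Delta$ satisfies the hard IQC defined by $(\Psi,M)$. Suppose there exist a $\mathcal{C}^1$ function $V:\mathbb{R}\times\mathbb{R}^{n}\times\mathbb{R}^{n_u}\to\mathbb{R}$ and a control law $\tilde k:\mathbb{R}\times\mathbb{R}^{n_G}\times\mathbb{R}^{n_u}\to\mathbb{R}^{n_u}$ such that: (i) for all $(t,x,\tilde x,w,d)\in[0,T]\times\mathbb{R}^n\times\mathbb{R}^{n_u}\times\mathbb{R}^{n_w}\times\mathbb{R}^{n_d}$ with $V(t,x,\tilde x)\le\gamma+R^2$, $$\partial_tV(t,x,\tilde x)+\partial_xV(t,x,\tilde x)\cdot F(x,w,d,\tilde x)+\partial_{\tilde x}V(t,x,\tilde x)\cdot\tilde k(t,x_G,\tilde x)+z^\top Mz\le d^\top d,$$ where $z=H(x,w,d,\tilde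 x)$; (ii) for every $(x_\psi,\tilde x)\in\mathbb{R}^{n_\psi}\times U$, $\{x_G\in\mathbb{R}^{n_G}:V(T,[x_G;x_\psi],\tilde x)\le\gamma+R^2\}\subseteq X_T$; (iii) for every $i=1,\dots,n_p$ and all $(t,x,\tilde x)\in[0,T]\times\mathbb{R}^n\times\mathbb{R}^{n_u}$ with $V(t,x,\tilde x)\le\gamma+R^2$, $P_i\tilde x\le b_i$, where $P_i$ is the $i$-th row of $P$. Then the intersection of $\Omega^V_{0,\gamma}=\{(x,\tilde x):V(0,x,\tilde x)\le\gamma\}$ with the hyperplane $(x_\psi,\tilde x)=0$, i.e. the set $\{\xi\in\mathbb{R}^{n_G}:V(0,[\xi;0],0)\le\gamma\}$, is an inner-approximation to $BRS(T,X_T,U,R,F_u(G,\Delta))$ under the dynamic controller $$\dot{\tilde x}(t)=\tilde k(t,x_G(t),\tilde x(t)),\qquad u(t)=\tilde x(t),\qquad \tilde x(0)=0.$$ That is, for every $\xi$ in this set and every $d$ with $\|d\|_{2,[0,T]}<R$, the solution of the uncertain system in closed loop with this controller, with $x_G(0)=\xi$, satisfies $u(t)\in U$ for all $t\in[0,T]$ and $x_G(T)\in X_T$.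
   Context: Signals and norms. $\mathcal{L}_2^{m}$ is the space of measurable $r:[0,\infty)\to\mathbb{R}^m$ with $\int_0^\infty r^\top r\,dt<\infty$; $\|r\|_{2,[0,T]}=(\int_0^T r(t)^\top r(t)\,dt)^{1/2}$, and $r\in\mathcal{L}_2^m[0,T]$ if this is finite. $\mathbb{S}^m$ denotes the real symmetric $m\times m$ matrices. $\mathbb{RH}_\infty$ denotes rational functions with real coefficients that are analytic in the closed right half plane (stable transfer functions). Uncertain system $F_u(G,\Delta)$ with actuator uncertainty. State $x_G(t)\in\mathbb{R}^{n_G}$, control $u(t)\in U\subseteq\mathbb{R}^{n_u}$, disturbance $d(t)\in\mathbb{R}^{n_d}$, and $v(t)\in\mathbb{R}^{n_v}$, $w(t)\in\mathbb{R}^{n_w}$ the input and output of the perturbation $\Delta$. The maps $f:\mathbb{R}^{n_G}\times\mathbb{R}^{n_w}\times\mathbb{R}^{n_d}\to\mathbb{R}^{n_G}$, $g:\mathbb{R}^{n_G}\times\mathbb{R}^{n_w}\times\mathbb{R}^{n_d}\to\mathbb{R}^{n_G\times n_u}$, $h:\mathbb{R}^{n_G}\times\mathbb{R}^{n_w}\times\mathbb{R}^{n_d}\times\mathbb{R}^{n_u}\to\mathbb{R}^{n_v}$ define the nominal system $G$; $v$ may depend directly on $u$. $\Delta:\mathcal{L}_2^{n_v}\to\mathcal{L}_2^{n_w}$ is a bounded, causal operator. Solutions. $x_G(t;\xi,u,d)$, $0\le t\le T$, denotes the solution of the uncertain system with initial condition $\xi$, control $u$ and disturbance $d$. Solutions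 (including those of the closed loop with a dynamic controller) are understood to exist on $[0,T]$: the states are absolutely continuous and satisfy the differential equations almost everywhere, $v\in\mathcal{L}_2^{n_v}[0,T]$, $w\in\mathcal{L}_2^{n_w}[0,T]$, and $w=\Delta(v)$ on $[0,T]$ (by causality, $v$ may be extended by zero beyond $T$). Statements about ''the solution'' apply to every such solution. Backward reachable set. $BRS(T,X_T,U,R,F_u(G,\Delta))$ is the set of $\xi\in\mathbb{R}^{n_G}$ for which there is a control $u$ with $u(t)\in U$ for all $t\in[0,T]$ and $x_G(T;\xi,u,d)\in X_T$ for all $d$ with $\|d\|_{2,[0,T]}<R$. Here the control may be given by (dynamic) feedback. Filter. $\Psi\in\mathbb{RH}_\infty^{n_z\times(n_v+n_w)}$ is an LTI system driven by $(v,w)$ with state $x_\psi(t)\in\mathbb{R}^{n_\psi}$, zero initial condition $x_\psi(0)=0$, and $\dot x_\psi=A_\psi x_\psi+B_{\psi1}v+B_{\psi2}w$, $z=C_\psi x_\psi+D_{\psi1}v+D_{\psi2}w\in\mathbb{R}^{n_z}$. Hard IQC. $\Delta$ satisfies the hard IQC defined by $(\Psi,M)$, $M\in\mathbb{S}^{n_z}$, if for all $v\in\mathcal{L}_2^{n_v}$ and $w=\Delta(v)$ the filter output $z$ satisfies $\int_0^t z(\tau)^\top Mz(\tau)\,d\tau\ge0$ for all $t\in[0,T]$. Extended system. With $x=[x_G;x_\psi]\in\mathbb{R}^n$, the interconnection of $G$ and $\Psi$ is $\dot x=F(x,w,d,u)$, $z=H(x,w,d,u)$, where $F(x,w,d,u)=\begin{bmatrix}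 f(x_G,w,d)+g(x_G,w,d)u\\ A_\psi x_\psi+B_{\psi1}h(x_G,w,d,u)+B_{\psi2}w\end{bmatrix}$ and $H(x,w,d,u)=C_\psi x_\psi+D_{\psi1}h(x_G,w,d,u)+D_{\psi2}w$. The variable $\tilde x\in\mathbb{R}^{n_u}$ is the auxiliary controller state, which equals the control command $u$. *)

(* Defs.v *)
From HB Require Import structures.
From mathcomp Require Import all_boot all_order all_algebra.
From mathcomp Require Import complex.
From mathcomp Require Import all_classical all_reals all_analysis.

Set Implicit Arguments.
Unset Strict Implicit.
Unset Printing Implicit Defensive.
Import Order.TTheory GRing.Theory Num.Theory.
Import numFieldNormedType.Exports.
Local Open Scope classical_set_scope.
Local Open Scope ring_scope.

Definition quad {R : realType} {m : nat} (M : 'M[R]_m) (z : 'cV[R]_m) : R :=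
  (z^T *m M *m z) ord0 ord0.

Definition half_line {R : realType} : set R := `[0, +oo[.

Definition sqnorm {R : realType} {m : nat} (r : 'cV[R]_m) : R :=
  (r^T *m r) ord0 ord0.

Definition l2norm {R : realType} {m : nat} (D : set R) (r : R -> 'cV[R]_m)
    : \bar R :=
  ((\int[@lebesgue_measure R]_(t in D) (sqnorm (r t))%:E) `^ 2^-1)%E.

Definition L2 {R : realType} {m : nat} (D : set R) (r : R -> 'cV[R]_m) : Prop :=
  (forall i, measurable_fun D (fun t => r t i ord0)) /\ (l2norm D r < +oo)%E.

Definition ae_on {R : realType} (D : set R) (P : R -> Prop) : Prop :=
  {ae @lebesgue_measure R, forall t, D t -> P t}.

(** The norm on column vectors is the max norm; all norms being equivalent,
    this does not affect absolute continuity. *)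
Definition abs_continuous {R : realType} {m : nat} (T : R) (x : R -> 'cV[R]_m)
    : Prop :=
  forall eps : R, 0 < eps -> exists2 delta : R, 0 < delta &
    forall (k : nat) (a b : 'I_k -> R),
      (forall i, 0 <= a i /\ a i <= b i /\ b i <= T) ->
      trivIset setT (fun i => `]a i, b i[%classic) ->
      \sum_(i < k) (b i - a i) < delta ->
      \sum_(i < k) `|x (b i) - x (a i)| < eps.

Definition solves_ode {R : realType} {m : nat} (T : R)
    (x rhs : R -> 'cV[R]_m) : Prop :=
  abs_continuous T x /\
  ae_on `[0, T] (fun t => is_derive t 1 x (rhs t)).

Record system (R : realType) (nG nu nd nv nw : nat) := System {
  sys_f : 'cV[R]_nG -> 'cV[R]_nw -> 'cV[R]_nd -> 'cV[R]_nG;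
  sys_g : 'cV[R]_nG -> 'cV[R]_nw -> 'cV[R]_nd -> 'M[R]_(nG, nu);
  sys_h : 'cV[R]_nG -> 'cV[R]_nw -> 'cV[R]_nd -> 'cV[R]_nu -> 'cV[R]_nv }.

(** Operators act on representatives of L2 classes. Causality, being stated up
    to almost everywhere equality, also makes them compatible with almost
    everywhere equality on the half line. *)
Definition bounded_causal {R : realType} {nv nw : nat}
    (Delta : (R -> 'cV[R]_nv) -> (R -> 'cV[R]_nw)) : Prop :=
  [/\ forall v, L2 half_line v -> L2 half_line (Delta v),
      exists c : R, forall v, L2 half_line v ->
        (l2norm half_line (Delta v) <= c%:E * l2norm half_line v)%E &
      forall t v1 v2, 0 <= t -> L2 half_line v1 -> L2 half_line v2 ->
        ae_on `[0, t] (fun s => v1 s = v2 s) ->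
        ae_on `[0, t] (fun s => Delta v1 s = Delta v2 s)].

Definition zero_ext {R : realType} {m : nat} (T : R) (v : R -> 'cV[R]_m)
    : R -> 'cV[R]_m :=
  patch (fun=> 0) `[0, T] v.

Definition system_solution {R : realType} {nG nu nd nv nw : nat} (T : R)
    (G : system R nG nu nd nv nw)
    (Delta : (R -> 'cV[R]_nv) -> (R -> 'cV[R]_nw))
    (xi : 'cV[R]_nG) (u : R -> 'cV[R]_nu) (d : R -> 'cV[R]_nd)
    (xG : R -> 'cV[R]_nG) (v : R -> 'cV[R]_nv) (w : R -> 'cV[R]_nw) : Prop :=
  [/\ xG 0 = xi,
      solves_ode T xG (fun t => sys_f G (xG t) (w t) (d t)
                                + sys_g G (xG t) (w t) (d t) *m u t),
      L2 `[0, T] v /\ L2 `[0, T] w,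
      ae_on `[0, T] (fun t => v t = sys_h G (xG t) (w t) (d t) (u t)) &
      ae_on `[0, T] (fun t => w t = Delta (zero_ext T v) t)].

Definition disturbance {R : realType} {nd : nat} (T rad : R)
    (d : R -> 'cV[R]_nd) : Prop :=
  L2 `[0, T] d /\ (l2norm `[0%R, T] d < rad%:E)%E.

Record controller (R : realType) (nG nu : nat) := Controller {
  ctrl_dim : nat;
  ctrl_rhs : R -> 'cV[R]_nG -> 'cV[R]_ctrl_dim -> 'cV[R]_ctrl_dim;
  ctrl_out : R -> 'cV[R]_nG -> 'cV[R]_ctrl_dim -> 'cV[R]_nu;
  ctrl_init : 'cV[R]_ctrl_dim }.
Arguments ctrl_rhs {R nG nu} K _ _ _ : rename.
Arguments ctrl_out {R nG nu} K _ _ _ : rename.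

Definition integral_controller {R : realType} {nG nu : nat}
    (kt : R -> 'cV[R]_nG -> 'cV[R]_nu -> 'cV[R]_nu) : controller R nG nu :=
  @Controller R nG nu nu kt (fun _ _ xt => xt) 0.

Definition ctrl_command {R : realType} {nG nu : nat} (K : controller R nG nu)
    (xG : R -> 'cV[R]_nG) (xc : R -> 'cV[R]_(ctrl_dim K)) : R -> 'cV[R]_nu :=
  fun t => ctrl_out K t (xG t) (xc t).
Arguments ctrl_command {R nG nu} K xG xc _.

Definition closed_loop {R : realType} {nG nu nd nv nw : nat} (T : R)
    (G : system R nG nu nd nv nw)
    (Delta : (R -> 'cV[R]_nv) -> (R -> 'cV[R]_nw)) (K : controller R nG nu)
    (xi : 'cV[R]_nG) (d : R -> 'cV[R]_nd)
    (xG : R -> 'cV[R]_nG) (xc : R -> 'cV[R]_(ctrl_dim K))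
    (v : R -> 'cV[R]_nv) (w : R -> 'cV[R]_nw) : Prop :=
  [/\ xc 0 = ctrl_init K,
      solves_ode T xc (fun t => ctrl_rhs K t (xG t) (xc t)) &
      system_solution T G Delta xi (ctrl_command K xG xc) d xG v w].
Arguments closed_loop {R nG nu nd nv nw} T G Delta K xi d xG xc v w.

Definition closed_loop_exists {R : realType} {nG nu nd nv nw : nat} (T rad : R)
    (G : system R nG nu nd nv nw)
    (Delta : (R -> 'cV[R]_nv) -> (R -> 'cV[R]_nw)) (K : controller R nG nu)
    (xi : 'cV[R]_nG) : Prop :=
  forall d, disturbance T rad d ->
    exists xG xc v w, closed_loop T G Delta K xi d xG xc v w.

Definition steers {R : realType} {nG nu nd nv nw : nat} (T : R)
    (XT : set 'cV[R]_nG) (U : set 'cV[R]_nu) (rad : R)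
    (G : system R nG nu nd nv nw)
    (Delta : (R -> 'cV[R]_nv) -> (R -> 'cV[R]_nw)) (K : controller R nG nu)
    (xi : 'cV[R]_nG) : Prop :=
  forall d xG xc v w, disturbance T rad d ->
    closed_loop T G Delta K xi d xG xc v w ->
    (forall t, 0 <= t <= T -> U (ctrl_command K xG xc t)) /\ XT (xG T).

(** Open-loop controls are the controllers of dimension 0. Existence of
    solutions is required so that a controller without closed-loop solutions
    does not put a state in the set vacuously. *)
Definition BRS {R : realType} {nG nu nd nv nw : nat} (T : R)
    (XT : set 'cV[R]_nG) (U : set 'cV[R]_nu) (rad : R)
    (G : system R nG nu nd nv nw)
    (Delta : (R -> 'cV[R]_nv) -> (R -> 'cV[R]_nw)) : set 'cV[R]_nG :=
  [set xi | exists K : controller R nG nu,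
     closed_loop_exists T rad G Delta K xi /\
     steers T XT U rad G Delta K xi].

Definition polytope {R : realType} {np nu : nat} (P : 'M[R]_(np, nu))
    (b : 'cV[R]_np) : set 'cV[R]_nu :=
  [set u | forall i, (P *m u) i ord0 <= b i ord0].

Record filter_lti (R : realType) (nv nw npsi nz : nat) := FilterLTI {
  fA : 'M[R]_npsi;
  fB1 : 'M[R]_(npsi, nv);
  fB2 : 'M[R]_(npsi, nw);
  fC : 'M[R]_(nz, npsi);
  fD1 : 'M[R]_(nz, nv);
  fD2 : 'M[R]_(nz, nw) }.

(** The transfer matrix [C (s I - A)^-1 [B1 B2] + [D1 D2]] over R(s). *)
Definition transfer {R : realType} {nv nw npsi nz : nat}
    (Psi : filter_lti R nv nw npsi nz) : 'M[{fraction {poly R}}]_(nz, nv + nw) :=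
  let iota := fun a : R => tofrac a%:P in
  map_mx iota (fC Psi)
    *m invmx ((tofrac 'X)%:M - map_mx iota (fA Psi))
    *m map_mx iota (row_mx (fB1 Psi) (fB2 Psi))
  + map_mx iota (row_mx (fD1 Psi) (fD2 Psi)).

(** Analytic in the closed right half plane: some representation as a quotient
    has no pole there. Transfer matrices of state-space systems are proper. *)
Definition RHinf {R : realType} (r : {fraction {poly R}}) : Prop :=
  exists p q : {poly R},
    r = tofrac p / tofrac q /\
    forall s : R[i], 0 <= complex.Re s ->
      ~~ root (map_poly (real_complex R) q) s.

Definition stable_filter {R : realType} {nv nw npsi nz : nat}
    (Psi : filter_lti R nv nw npsi nz) : Prop :=
  forall i j, RHinf (transfer Psi i j).

Definition filter_state {R : realType} {nv nw npsi nz : nat} (T : R)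
    (Psi : filter_lti R nv nw npsi nz)
    (v : R -> 'cV[R]_nv) (w : R -> 'cV[R]_nw) (xpsi : R -> 'cV[R]_npsi) : Prop :=
  xpsi 0 = 0 /\
  solves_ode T xpsi
    (fun t => fA Psi *m xpsi t + fB1 Psi *m v t + fB2 Psi *m w t).

Definition filter_output {R : realType} {nv nw npsi nz : nat}
    (Psi : filter_lti R nv nw npsi nz)
    (xpsi : 'cV[R]_npsi) (v : 'cV[R]_nv) (w : 'cV[R]_nw) : 'cV[R]_nz :=
  fC Psi *m xpsi + fD1 Psi *m v + fD2 Psi *m w.

(** The filter state is determined by [v] and [w], so quantifying over all
    filter trajectories designates the unique one. *)
Definition hard_IQC {R : realType} {nv nw npsi nz : nat} (T : R)
    (Delta : (R -> 'cV[R]_nv) -> (R -> 'cV[R]_nw))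
    (Psi : filter_lti R nv nw npsi nz) (M : 'M[R]_nz) : Prop :=
  forall v, L2 half_line v ->
  forall xpsi, filter_state T Psi v (Delta v) xpsi ->
  forall t, 0 <= t <= T ->
    (0 <= \int[@lebesgue_measure R]_(s in `[0%R, t])
            (quad M (filter_output Psi (xpsi s) (v s) (Delta v s)))%:E)%E.

Definition ext_F {R : realType} {nG nu nd nv nw npsi nz : nat}
    (G : system R nG nu nd nv nw) (Psi : filter_lti R nv nw npsi nz)
    (x : 'cV[R]_(nG + npsi)) (w : 'cV[R]_nw) (d : 'cV[R]_nd) (u : 'cV[R]_nu)
    : 'cV[R]_(nG + npsi) :=
  let xG := usubmx x in let xpsi := dsubmx x in
  col_mx (sys_f G xG w d + sys_g G xG w d *m u)
         (fA Psi *m xpsi + fB1 Psi *m sys_h G xG w d u + fB2 Psi *m w).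

Definition ext_H {R : realType} {nG nu nd nv nw npsi nz : nat}
    (G : system R nG nu nd nv nw) (Psi : filter_lti R nv nw npsi nz)
    (x : 'cV[R]_(nG + npsi)) (w : 'cV[R]_nw) (d : 'cV[R]_nd) (u : 'cV[R]_nu)
    : 'cV[R]_nz :=
  filter_output Psi (dsubmx x) (sys_h G (usubmx x) w d u) w.

(** Fréchet differentiable with continuous differential; in finite dimension,
    continuity of [p |-> 'd W p] amounts to continuity of [p |-> 'd W p e] for
    every [e]. *)
Definition C1 {R : realType} {n m : nat}
    (V : R -> 'cV[R]_n -> 'cV[R]_m -> R) : Prop :=
  let W := fun p : R * 'cV[R]_n * 'cV[R]_m => V p.1.1 p.1.2 p.2 in
  (forall p, differentiable W p) /\ (forall e, continuous (fun p => 'd W p e)).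

(* Main.v *)
(** Along a closed-loop trajectory the filter state [xpsi] driven by [v] and [w]
    exists by variation of constants, so hypothesis (i) bounds the derivative of
    [W t = V t (xG t, xpsi t) (xt t)] by [|d|^2 - z^T M z] almost everywhere, as
    long as [W <= gamma + rad^2]. Integrating and using the hard IQC gives
    [W t <= W 0 + \int_0^t |d|^2 < gamma + rad^2], and a continuity argument shows
    that the sublevel set is never left; (ii) and (iii) then conclude.

    The integration step needs that an absolutely continuous function whose
    derivative is nonpositive almost everywhere is nonincreasing. *)

Require Import Defs.
From HB Require Import structures.
From mathcomp Require Import all_boot all_order all_algebra.
From mathcomp Require Import all_classical all_reals all_analysis.
From mathcomp Require Import measurable_realfun.
From mathcomp Require Import ring lra.

Set Implicit Arguments.
Unset Strict Implicit.
Unset Printing Implicit Defensive.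
Import Order.TTheory GRing.Theory Num.Theory.
Import numFieldNormedType.Exports.
Local Open Scope classical_set_scope.
Local Open Scope ring_scope.

(* The measure-theoretic lemmas of the library use the display of
   [measurableTypeR]; it is convertible to the default one of [L2]. *)
Local Notation mfun D f := (@measurable_fun _ _ (measurableTypeR _) _ D f).

(** * Absolute continuity *)

(** [W] is compared with a primitive [Phi] of [|d|^2 - z^T M z]: the difference [W - Phi] does not
    increase while the trajectory stays in the sublevel set. The differential equations hold only
    almost everywhere, so monotonicity has to come from absolute continuity. [V] adds an obstacle: a
    C1 function is only locally Lipschitz, so absolute continuity of [W] is obtained only near each
    time, and monotonicity and invariance are both made global by induction along a segment. The
    room for this induction comes from the strict bound on the disturbance: [c], the integral of
    [|d|^2] over [[0, T]], is smaller than [rad^2] and independent of [t], so [W <= gamma + rad^2]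
    on [[0, t]] improves to [W t <= gamma + c]. As the IQC concerns [Delta] on half-line signals,
    the filter is driven by the zero extension of [v] and its image under [Delta]. *)

Lemma segment_ind (R : realType) (a b : R) (Q : R -> Prop) : a <= b -> Q a ->
  (forall s, a <= s <= b -> exists2 e : R, 0 < e & forall u v, a <= u <= s ->
     s <= v <= b -> s - u < e -> v - s < e -> Q u -> Q v) -> Q b.
Proof.
(* Continuous induction: a point of [S] just below [sup S] carries [Q] across [sup S], which
   contradicts the supremum unless [sup S = b]. *)
move=> ab Qa step; pose S := [set t | a <= t <= b /\ Q t].
have Sa : S a by split; rewrite ?lexx.
have hS : has_sup S by split; [exists a|exists b => t [/andP[]]].
have sab : a <= sup S <= b.
  by rewrite ub_le_sup ?ge_sup//; [exists a|move=> t [/andP[]]|case: hS].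
have [e e0 he] := step _ sab.
have [u [/andP[au ub] Qu] us] := sup_adherent e0 hS.
have uS : u <= sup S by apply: ub_le_sup; [case: hS|split; rewrite ?au].
have Qv v : sup S <= v <= b -> v - sup S < e -> Q v.
  by move=> sv ve; apply: (he u v) => //; lra.
have [sb|bs] := ltP (sup S) b; last by apply: Qv; move: sab; lra.
pose v := Num.min b (sup S + e / 2).
have [sv vb ve] : [/\ sup S < v, v <= b & v - sup S < e].
  by rewrite /v; case: (leP b) => ?; split; lra.
have : v <= sup S.
  apply: ub_le_sup; first by case: hS.
  by split; [|apply: Qv]; move: sab; lra.
by lra.
Qed.

(** [abs_continuous] of the definitions, for arbitrary segments and values. *)
Definition ac_on (R : realType) (V : normedModType R) (a b : R) (f : R -> V) :=
  forall eps : R, 0 < eps -> exists2 delta : R, 0 < delta &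
    forall (k : nat) (s e : 'I_k -> R),
      (forall i, a <= s i /\ s i <= e i /\ e i <= b) ->
      trivIset setT (fun i => `]s i, e i[%classic) ->
      \sum_(i < k) (e i - s i) < delta ->
      \sum_(i < k) `|f (e i) - f (s i)| < eps.

Section absolute_continuity.
Context {R : realType}.
Implicit Types (V W : normedModType R) (a b : R).

Lemma ac_onS V a b a' b' (f : R -> V) : a <= a' -> b' <= b ->
  ac_on a b f -> ac_on a' b' f.
Proof.
move=> aa bb acf eps eps0; have [d d0 hd] := acf _ eps0.
exists d => // k s e se; apply: hd => i.
by have [? [? ?]] := se i; repeat split => //; lra.
Qed.

(** Only increments are compared, and [f] may live in another space. A pair can thus play the role
    of [f], which is how sums, products and compositions with [V] are treated. *)
Lemma ac_on_lip V W a b (f : R -> V) (g : R -> W) (L : R) :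
  (forall s t, a <= s -> s <= t -> t <= b ->
     `|g t - g s| <= L * `|f t - f s|) ->
  ac_on a b f -> ac_on a b g.
Proof.
move=> gf acf eps eps0; have L0 : 0 < `|L| + 1 by rewrite ltr_wpDl.
have [d d0 hd] := acf _ (divr_gt0 eps0 L0).
exists d => // k s e se tr sd.
rewrite (@le_lt_trans _ _ ((`|L| + 1) * \sum_(i < k) `|f (e i) - f (s i)|))//.
  rewrite mulr_sumr; apply: ler_sum => i _; have [? [? ?]] := se i.
  apply: le_trans (gf _ _ _ _ _) _ => //; rewrite ler_wpM2r//.
  by have := ler_norm L; lra.
by rewrite mulrC -ltr_pdivlMr//; exact: hd.
Qed.

Lemma ac_on_id a b : ac_on a b (fun t : R => t : R^o).
Proof.
move=> eps eps0; exists eps => // k s e se _; apply: le_lt_trans.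
by apply: ler_sum => i _; have [? [? ?]] := se i; rewrite ger0_norm// subr_ge0.
Qed.

Lemma ac_on_pair V W a b (f : R -> V) (g : R -> W) :
  ac_on a b f -> ac_on a b g -> ac_on a b (fun t => (f t, g t)).
Proof.
move=> acf acg eps eps0; have e20 : 0 < eps / 2 by rewrite divr_gt0.
have [d d0 hd] := acf _ e20; have [d' d'0 hd'] := acg _ e20.
exists (Num.min d d'); first by rewrite lt_min d0.
move=> k s e se tr; rewrite lt_min => /andP[sd sd'].
rewrite (splitr eps); apply: le_lt_trans (ltrD (hd _ _ _ se tr sd) (hd' _ _ _ se tr sd')).
rewrite -big_split; apply: ler_sum => i _ /=.
by rewrite prod_normE ge_max/= lerDl lerDr !normr_ge0.
Qed.

Lemma ac_onD V a b (f g : R -> V) :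
  ac_on a b f -> ac_on a b g -> ac_on a b (fun t => f t + g t).
Proof.
(* Each component is bounded by the max norm of the pair, hence the constant 2. *)
move=> acf acg; apply: (@ac_on_lip _ _ _ _ _ _ 2 _ (ac_on_pair acf acg)).
move=> s t _ _ _; rewrite opprD addrACA (le_trans (ler_normD _ _))//.
rewrite prod_normE/= mulr_natl mulr2n lerD// le_max lexx ?orbT//.
Qed.

Lemma ac_onN V a b (f : R -> V) : ac_on a b f -> ac_on a b (fun t => - f t).
Proof.
by apply: (@ac_on_lip _ _ _ _ _ _ 1) => s t _ _ _; rewrite mul1r -opprD normrN.
Qed.

Lemma ac_on_sum V a b (I : finType) (f : I -> R -> V) :
  (forall i, ac_on a b (f i)) -> ac_on a b (fun t => \sum_i f i t).
Proof.
move=> acf; elim: (index_enum I) => [|i r ih].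
  apply: (@ac_on_lip _ _ _ _ _ _ 0 _ (@ac_on_id a b)) => s t _ _ _.
  by rewrite !big_nil subrr normr0 mul0r.
rewrite (_ : (fun t => _) = fun t => f i t + \sum_(j <- r) f j t).
  exact: ac_onD.
by apply/funext => t; rewrite big_cons.
Qed.

Lemma ac_on_mx m n a b (x : R -> 'M[R]_(m, n)) :
  (forall i j, ac_on a b (fun t => x t i j : R^o)) -> ac_on a b x.
Proof.
move=> acx.
rewrite (_ : x = fun t => \sum_i \sum_j x t i j *: delta_mx i j).
  do 2![apply: ac_on_sum => ?].
  apply: (ac_on_lip (L := `|delta_mx _ _ : 'M[R]_(m, n)|) _ (acx _ _)) => s t _ _ _.
  by rewrite -scalerBl normrZ mulrC.
by apply/funext => t; exact: matrix_sum_delta.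
Qed.

Lemma ac_on_continuous V a b (f : R -> V) : ac_on a b f ->
  forall eps : R, 0 < eps -> exists2 d : R, 0 < d &
    forall s t, a <= s <= b -> a <= t <= b -> `|t - s| < d ->
      `|f t - f s| < eps.
Proof.
move=> acf eps eps0; have [d d0 hd] := acf _ eps0; exists d => // s t.
wlog st : s t / s <= t => [H|] hs ht.
  have [|/ltW ts] := leP s t; first by move=> *; exact: H.
  by rewrite distrC [X in _ -> X < _]distrC; exact: H.
rewrite ger0_norm ?subr_ge0// => tsd.
have := hd 1 (fun=> s) (fun=> t); rewrite !big_ord1; apply => //.
  by move=> _; move: hs ht; lra.
by move=> i j _ _ _; rewrite !ord1.
Qed.

End absolute_continuity.

Lemma sum_length_le (R : realType) (k : nat) (s e : 'I_k -> R) (U : set R) :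
  (forall i, s i <= e i) -> trivIset setT (fun i => `]s i, e i[%classic) ->
  measurable U -> (forall i, `]s i, e i[%classic `<=` U) ->
  ((\sum_(i < k) (e i - s i))%:E <= @lebesgue_measure R U)%E.
Proof.
move=> se tr mU seU.
rewrite (_ : _%:E = @lebesgue_measure R (\big[setU/set0]_(i < k) `]s i, e i[%classic)).
  apply: le_measure; rewrite ?inE//; first exact: bigsetU_measurable.
  by elim/big_ind: _ => // A B AU BO z [/AU|/BO].
rewrite measure_bigsetU_ord//= -sumEFin; apply: eq_bigr => i _.
rewrite lebesgue_measure_itv/= lte_fin; case: ltP => // es.
by rewrite (@le_anti _ _ (e i) (s i)) ?subrr// se es.
Qed.

(** Straddle estimate: because [s] lies between [u] and [v], the errors [eps * (v - s)] and
    [eps * (s - u)] of the two sides add up to exactly [eps * (v - u)]. *)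
Lemma is_derive_le_near (R : realType) (f : R -> R) (s l eps : R) :
  is_derive s 1 f l -> l <= 0 -> 0 < eps ->
  exists2 d : R, 0 < d & forall u v, u <= s -> s <= v -> s - u < d -> v - s < d ->
    f v - f u <= eps * (v - u).
Proof.
move=> [df <-] l0 eps0.
have /cvgrPdist_lt/(_ _ eps0)[d /= d0 hd] := df.
exists d => // u v us sv ud vd.
have H t : t != s -> `|t - s| < d -> `|'D_1 f s - (t - s)^-1 * (f t - f s)| < eps.
  move=> ts tsd; have := hd (t - s); rewrite /= sub0r normrN subr_eq0 => /(_ tsd ts).
  by rewrite [_ *: 1]mulr1 subrK.
have Hv : f v - f s <= eps * (v - s).
  have [->|vs] := eqVneq v s; first by rewrite !subrr mulr0.
  have vs0 : 0 < v - s by rewrite subr_gt0 lt_neqAle eq_sym vs.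
  have := H v vs; rewrite ger0_norm ?(ltW vs0)// => /(_ vd).
  rewrite ltr_norml => /andP[h _]; rewrite -ler_pdivrMr// mulrC.
  by move: h l0; set q := _^-1 * _; set D := 'D_1 f s; lra.
have Hu : f s - f u <= eps * (s - u).
  have [->|us'] := eqVneq u s; first by rewrite !subrr mulr0.
  have us0 : 0 < s - u by rewrite subr_gt0 lt_neqAle us'.
  have := H u us'; rewrite distrC ger0_norm ?(ltW us0)// => /(_ ud).
  rewrite ltr_norml => /andP[h _]; rewrite -ler_pdivrMr// mulrC.
  rewrite -(opprB u s) -(opprB (f u)) invrN mulrNN.
  by move: h l0; set q := _^-1 * _; set D := 'D_1 f s; lra.
by move: Hv Hu; rewrite -(subrK s v) -[v - s + s - u]addrA; rewrite mulrDr; lra.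
Qed.

(* Gauge argument: outside a null set the derivative controls the increments of
   [f] on short intervals, and the intervals around the remaining points lie in
   an open set of small measure, where absolute continuity controls them. *)
Lemma ac_on_derive_le0 (R : realType) (a b : R) (f : R -> R) :
  a <= b -> ac_on a b (f : R -> R^o) ->
  ae_on `[a, b] (fun t => exists2 l, is_derive t 1 f l & l <= 0) -> f b <= f a.
Proof.
move=> ab acf [A [mA A0' hA]].
have A0 : @lebesgue_measure R A = 0%E := A0'.
suff: forall eps : R, 0 < eps -> f b - f a <= eps * (b - a) + eps.
  move=> H; rewrite -subr_le0; apply/ler_addgt0Pl => eps eps0; rewrite addr0.
  (* With this value the two error terms add up to [eps]; the summand 1 keeps the denominator
     positive when [a = b]. *)
  have eab : 0 < eps / (b - a + 1) by rewrite divr_gt0//; lra.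
  have := H _ eab; rewrite -{2}(mulr1 (eps / _)) -mulrDr divfK//; lra.
move=> eps eps0; have [d d0 hd] := acf _ eps0.
have [U [oU AU mU]] : exists U : set R, [/\ open U, A `<=` U &
    (@lebesgue_measure R U < d%:E)%E].
  have [|U [oU AU muU]] := @lebesgue_regularity_outer R A d mA _ d0.
    by apply: le_lt_trans (ltry 0); rewrite le_eqVlt; apply/orP; left; apply/eqP.
  have mU : measurable U by exact: open_measurable.
  exists U; split => //; rewrite -(setDUK AU) measureU//.
  - by rewrite [X in (X + _)%E](_ : _ = 0%E) ?add0e.
  - exact: measurableD.
  - by rewrite setDIK.
(* The intervals around exceptional points are recorded rather than estimated one by one: absolute
   continuity bounds only their total contribution, once [b] is reached. *)
pose Q t := exists k, exists s e : 'I_k -> R,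
  [/\ forall i, a <= s i /\ s i <= e i /\ e i <= t,
      trivIset setT (fun i => `]s i, e i[%classic),
      forall i, `]s i, e i[%classic `<=` U &
      f t - f a <= eps * (t - a) + \sum_(i < k) `|f (e i) - f (s i)|].
suff [k [s [e [se tr seU fb]]]] : Q b.
  apply: le_trans fb _; rewrite lerD2l ltW//; apply: hd => //.
  rewrite -lte_fin; apply: le_lt_trans mU; apply: sum_length_le => //.
    by move=> i; have [? []] := se i.
  exact: open_measurable.
apply: (segment_ind ab).
  exists 0%N, (fun=> a), (fun=> a); split; try by case.
  by rewrite big_ord0 !subrr mulr0 addr0.
move=> s asb; have [sA|sA] := pselect (A s).
  have /nbhs_ballP[e e0 he] : nbhs s U by apply: open_nbhs_nbhs; split=> //; exact: AU.
  exists e => // u v /andP[au us] /andP[sv vb] ue ve [k [p [q [pq tr pqU fu]]]].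
  (* The new interval []u, v[] takes index 0; it is disjoint from the recorded ones, which all end
     at or before [u]. *)
  exists k.+1, (fun i => oapp p u (unlift ord0 i)), (fun i => oapp q v (unlift ord0 i)).
  split.
  - move=> i; case: unliftP => [j _|_] /=; last by lra.
    by have [? [? ?]] := pq j; lra.
  - move=> i j _ _; case: unliftP => [i' ->|->]; case: unliftP => [j' ->|->] //=.
    + by move=> /(tr _ _ I I) ->.
    + move=> [z [/=]]; rewrite !in_itv/= => /andP[_ zq] /andP[uz _].
      by exfalso; have [? [? ?]] := pq i'; lra.
    + move=> [z [/=]]; rewrite !in_itv/= => /andP[uz _] /andP[_ zq].
      by exfalso; have [? [? ?]] := pq j'; lra.
  - move=> i; case: unliftP => [j _|_] /=; first exact: pqU.
    move=> z /=; rewrite in_itv/= => /andP[uz zv]; apply: he.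
    by rewrite /ball/= ltr_norml; lra.
  - rewrite big_ord_recl unlift_none /=.
    under eq_bigr do rewrite liftK/=.
    have := ler_norm (f v - f u).
    have : eps * (u - a) <= eps * (v - a) by rewrite ler_wpM2l ?(ltW eps0)//; lra.
    by move: fu; lra.
have [l fl l0] : exists2 l, is_derive s 1 f l & l <= 0.
  apply: contrapT => H; apply: sA; apply: hA => /= H'; apply: H.
  by apply: H'; rewrite in_itv.
have [e e0 he] := is_derive_le_near fl l0 eps0.
exists e => // u v /andP[au us] /andP[sv vb] ue ve [k [p [q [pq tr pqU fu]]]].
exists k, p, q; split => //.
  by move=> i; have [? [? ?]] := pq i; lra.
have := he u v us sv ue ve; move: fu.
have -> : eps * (v - a) = eps * (v - u) + eps * (u - a) by ring.
lra.
Qed.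

(** [segment_ind] with [Q t := f t <= f a] takes the place of a finite subcover of [[a, b]]. *)
Lemma locally_ac_derive_le0 (R : realType) (a b : R) (f : R -> R) : a <= b ->
  (forall s, a <= s <= b -> exists2 d : R, 0 < d &
     ac_on (Num.max a (s - d)) (Num.min b (s + d)) (f : R -> R^o)) ->
  ae_on `[a, b] (fun t => exists2 l, is_derive t 1 f l & l <= 0) -> f b <= f a.
Proof.
move=> ab locf [A [mA A0 hA]].
apply: (segment_ind (Q := fun t => f t <= f a) ab) => //= s /locf[d d0 acf].
exists d => // u v /andP[au us] /andP[sv vb] ud vd; apply: le_trans.
apply: (ac_on_derive_le0 (le_trans us sv)).
  by apply: ac_onS acf; rewrite ?ge_max ?le_min; lra.
exists A; split => // t /= H; apply: hA => /= H'; apply: H => tuv; apply: H'.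
by move: tuv; rewrite !in_itv/=; lra.
Qed.

(** * Lebesgue primitives *)

Section almost_everywhere.
Context {R : realType}.
Implicit Types (D E : set R) (P Q : R -> Prop).

Lemma ae_onS D E P Q : E `<=` D -> (forall t, E t -> P t -> Q t) ->
  ae_on D P -> ae_on E Q.
Proof.
move=> ED PQ; apply: (@filterS _ _ (ae_filter_ringOfSetsType _)).
by move=> t DP Et; apply: PQ => //; exact/DP/ED.
Qed.

Lemma ae_onI D P Q : ae_on D P -> ae_on D Q -> ae_on D (fun t => P t /\ Q t).
Proof.
move=> DP DQ; apply: (@filterS2 _ _ (ae_filter_ringOfSetsType _) _ _ _ _ DP DQ).
by move=> t P' Q' Dt; split; [exact: P'|exact: Q'].
Qed.

End almost_everywhere.

Section primitive.
Context {R : realType}.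
Notation mu := (@lebesgue_measure R).
Variable f : R -> R.
Hypothesis intf : mu.-integrable setT (EFin \o f).

Definition primitive (t : R) : R := \int[mu]_(x in `[0, t]) f x.

Let intS (A : set R) : measurable A -> mu.-integrable A (EFin \o f).
Proof. by move=> mA; apply: integrableS intf. Qed.

Lemma primitive0 : primitive 0 = 0.
Proof. by rewrite /primitive set_itv1 Rintegral_set1. Qed.

(** The open interval on the right lets these bounds add up over the disjoint open intervals of
    [ac_on]. *)
Lemma primitiveB_le (s e : R) : 0 <= s -> s <= e ->
  (`|primitive e - primitive s|%:E <= \int[mu]_(x in `]s, e[) `|f x|%:E)%E.
Proof.
move=> s0 se.
rewrite /primitive Rintegral_itvB ?bnd_simp//; last exact: intS.
rewrite -Rintegral_itv_bndo_bndc; last exact: intS.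
rewrite EFin_normr_Rintegral//; last exact: intS.
by apply: le_abse_integral => //; case/integrableP: (@intS `]s, e[%classic (measurable_itv _)).
Qed.

(** The union of the intervals has small measure, and the integral of [|f|] is uniformly small over
    sets of small measure. *)
Lemma ac_on_primitive (T : R) : ac_on 0 T (primitive : R -> R^o).
Proof.
move=> eps eps0; have [d [d0 hd]] := integral_normr_continuous intf eps0.
exists d => // k s e se tr sd.
pose A := \big[setU/set0]_(i < k) `]s i, e i[%classic.
have mA : measurable A by exact: bigsetU_measurable.
have muA : (mu A < d%:E)%E.
  rewrite /A measure_bigsetU_ord//.
  apply: (@le_lt_trans _ _ (\sum_(i < k) (e i - s i))%:E); last by rewrite lte_fin.
  rewrite -sumEFin; apply: lee_sum => i _; have [_ [sei _]] := se i.
  by rewrite /= lebesgue_measure_itv/=; case: ifP => _; rewrite lee_fin ?lexx// subr_ge0.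
move: (hd _ mA muA); rewrite -2!lte_fin; apply: le_lt_trans.
rewrite /Rintegral.
have mf : mfun [set: R] (fun x => `|f x| : R).
  apply: measurableT_comp => //.
  by case/integrableP: intf => /measurable_EFinP.
rewrite fineK; last first.
  have /integrable_abse /(@integrable_fin_num _ _ _ mu A) := intS mA.
  exact.
rewrite -sumEFin /A ge0_integral_bigsetU//=; last 3 first.
- exact: index_enum_uniq.
- exact: sub_trivIset tr.
- by apply/measurable_EFinP; apply: measurable_funS mf.
- by apply: lee_sum => i _; have [? [? _]] := se i; exact: primitiveB_le.
Qed.

Lemma is_derive_primitive T : ae_on `[0, T] (fun t => is_derive t 1 primitive (f t)).
Proof.
have locf : locally_integrable setT f.
  by apply: open_integrable_locally => //; exact: openT.
(* [FTC1] yields the derivative only strictly to the right of the lower bound; the point 0 is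
   discarded as a null set. *)
have ne0 : ae_on `[0, T] (fun t => t != 0).
  exists [set 0]; split => //; first exact: lebesgue_measure_set1.
  by move=> t /= H; apply/eqP; apply: contrapT => t0; apply: H => _; exact/negP.
have := FTC1 (a := BLeft 0) (fun y => intS (measurable_itv _)) locf.
apply: (@filterS2 _ _ (ae_filter_ringOfSetsType _) _ _ _ _ ne0).
move=> t /= t0 H t0T; have [] := H; last first.
  by move=> df <-; rewrite derive1E; exact: derivableP.
by rewrite lte_fin lt_neqAle eq_sym t0//; move: t0T; rewrite in_itv/= => /andP[].
Qed.

End primitive.

(** * The matrix exponential *)

Lemma is_derive_mx (R : realType) (m n : nat) (x : R -> 'M[R]_(m, n))
    (dx : 'M[R]_(m, n)) (t : R) :
  (forall i j, is_derive t 1 (fun s => x s i j) (dx i j)) -> is_derive t 1 x dx.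
Proof.
move=> H; have dfx : derivable x t 1 by apply/derivable_mxP => i j; case: (H i j).
apply: DeriveDef => //; rewrite derive_mx//; apply/matrixP => i j.
by rewrite mxE; case: (H i j).
Qed.

Lemma is_derive_mx_entry (R : realType) (m n : nat) (x : R -> 'M[R]_(m, n))
    (dx : 'M[R]_(m, n)) (t : R) i j :
  is_derive t 1 x dx -> is_derive t 1 (fun s => x s i j) (dx i j).
Proof.
move=> [dfx <-]; rewrite derive_mx// mxE; apply: derivableP.
by have /derivable_mxP := dfx; apply.
Qed.

Lemma is_derive_mulmx (R : realType) (m n p : nat) (A : R -> 'M[R]_(m, n))
    (B : R -> 'M[R]_(n, p)) dA dB (t : R) :
  is_derive t 1 A dA -> is_derive t 1 B dB ->
  is_derive t 1 (fun s => A s *m B s) (dA *m B t + A t *m dB).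
Proof.
move=> hA hB; apply: is_derive_mx => i j.
rewrite (_ : (fun s => _) = \sum_k (fun s => A s i k * B s k j)); last first.
  by apply/funext => s; rewrite mxE fct_sumE.
rewrite !mxE -big_split/=; apply: is_derive_sum => k.
have hAk := is_derive_mx_entry i k hA; have hBk := is_derive_mx_entry k j hB.
apply: (is_derive_eq (is_deriveM hAk hBk)).
by rewrite /= addrC; congr (_ + _); rewrite [LHS]mulrC.
Qed.

Section matrix_exponential.
Context {R : realType} {n : nat}.
Variable A : 'M[R]_n.

Let coef i j (k : nat) : R := (A ^+ k) i j / k`!%:R.

(** The matrix exponential [exp(tA)], taken entry by entry so that the theory of real power series
    applies. *)
Definition expmx (t : R) : 'M[R]_n := \matrix_(i, j) limn (pseries (coef i j) t).

(** The sum of the absolute values of all entries dominates every row sum, which makes the induction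
    work; it leads to comparison with the exponential series at [C * |t|]. *)
Let pow_le i j k : `|(A ^+ k) i j| <= (\sum_i \sum_j `|A i j|) ^+ k.
Proof.
set C := \sum_i _; have C0 : 0 <= C by do 2![apply: sumr_ge0 => ? _].
elim: k i j => [|k ih] i j.
  by rewrite !expr0 !mxE; case: eqP => _; rewrite ?normr1// normr0.
rewrite exprS -mulmxE mxE (le_trans (ler_norm_sum _ _ _))//.
apply: (@le_trans _ _ ((\sum_l `|A i l|) * C ^+ k)).
  by rewrite mulr_suml; apply: ler_sum => l _; rewrite normrM ler_wpM2l.
rewrite exprS ler_wpM2r ?exprn_ge0// /C [leRHS](bigD1 i)//= lerDl.
by do 2![apply: sumr_ge0 => ? _].
Qed.

Let cvg_coef i j t : pseries (coef i j) t @ \oo --> expmx t i j.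
Proof.
rewrite mxE; apply: normed_cvg.
set C := \sum_i \sum_j `|A i j|; have C0 : 0 <= C by do 2![apply: sumr_ge0 => ? _].
apply: (@series_le_cvg _ _ (exp_coeff (C * `|t|))) => [k|k|k|].
- exact: normr_ge0.
- by rewrite exp_coeff_ge0// mulr_ge0.
- rewrite /exp_coeff /coef/= normrM normrX exprMn mulrAC normrM normfV.
  rewrite (@ger0_norm _ _%:R)// ler_wpM2r ?invr_ge0//.
  by rewrite ler_wpM2r ?exprn_ge0.
- exact: is_cvg_series_exp_coeff.
Qed.

Let cvg_lincomb (I : finType) (a : I -> R) (c : I -> nat -> R) (L : I -> R) t :
  (forall l, pseries (c l) t @ \oo --> L l) ->
  pseries (fun k => \sum_l a l * c l k) t @ \oo --> \sum_l a l * L l.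
Proof.
move=> cL; rewrite (_ : pseries _ t = fun N => \sum_l a l * pseries (c l) t N).
  apply: cvg_big => [|l _]; first exact: add_continuous.
  by apply: cvgM; [exact: cvg_cst|exact: cL].
apply/funext => N; rewrite /pseries /series/=.
under [RHS]eq_bigr do rewrite mulr_sumr.
rewrite exchange_big/=; apply: eq_bigr => k _.
by rewrite mulr_suml; apply: eq_bigr => l _; rewrite mulrA.
Qed.

Let diffs_coefl i j : pseries_diffs (coef i j) = fun k => \sum_l A i l * coef l j k.
Proof.
apply/funext => k; rewrite /pseries_diffs /coef factS natrM invfM mulrCA mulVKf//.
by rewrite exprS -mulmxE mxE mulr_suml; apply: eq_bigr => l _; rewrite mulrA.
Qed.

Let diffs_coefr i j : pseries_diffs (coef i j) = fun k => \sum_l A l j * coef i l k.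
Proof.
apply/funext => k; rewrite /pseries_diffs /coef factS natrM invfM mulrCA mulVKf//.
rewrite exprSr -mulmxE mxE mulr_suml; apply: eq_bigr => l _.
by rewrite mulrA [X in X / _]mulrC.
Qed.

Let cvg_diffs i j t : pseries (pseries_diffs (coef i j)) t @ \oo --> (A *m expmx t) i j.
Proof. by rewrite diffs_coefl mxE; exact: cvg_lincomb. Qed.

(** Both sides are sums of the same differentiated series, since [A^(k+1)] is both [A A^k] and
    [A^k A]. *)
Lemma expmx_comm t : A *m expmx t = expmx t *m A.
Proof.
apply/matrixP => i j; have := cvg_diffs (i := i) (j := j) (t := t).
rewrite diffs_coefr => H; apply: (cvg_unique _ H) => //.
rewrite mxE; under eq_bigr do rewrite mulrC.
exact: cvg_lincomb.
Qed.

Lemma is_derive_expmx (t : R) : is_derive t 1 expmx (A *m expmx t).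
Proof.
apply: is_derive_mx => i j.
rewrite (_ : (fun s => _) = fun s => limn (pseries (coef i j) s)); last first.
  by apply/funext => s; rewrite mxE.
have <- : limn (pseries (pseries_diffs (coef i j)) t) = (A *m expmx t) i j.
  by apply/cvg_lim => //; exact: cvg_diffs.
(* Termwise differentiation at [t] asks for convergence of the series and of its first two
   differentiated series at some point of larger modulus; [|t| + 1] is such a point. *)
have tK : `|t| < `|(`|t| + 1)| by rewrite [ltRHS]ger0_norm ?addr_ge0// ltrDl.
apply: pseries_snd_diffs tK.
- by apply: cvgP; exact: cvg_coef.
- by apply: cvgP; exact: cvg_diffs.
- rewrite diffs_coefl.
  rewrite (_ : pseries_diffs _ = fun k => \sum_l A i l * pseries_diffs (coef l j) k).
    by apply: cvgP; apply: cvg_lincomb => l; exact: cvg_diffs.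
  apply/funext => k; rewrite {1}/pseries_diffs mulr_sumr.
  by apply: eq_bigr => l _; rewrite mulrCA.
Qed.

Lemma expmx0 : expmx 0 = 1%:M.
Proof.
apply/matrixP => i j; rewrite mxE; apply/cvg_lim => //.
(* The partial sum without terms is 0, so the sequence of partial sums is constant only from index 1
   on; hence the shift. *)
rewrite -(cvg_shiftS) (_ : [sequence _]_ _ = cst (1%:M i j)); first exact: cvg_cst.
apply/funext => k; rewrite /pseries /series/= big_nat_recl//= big1 => [|l _].
  by rewrite addr0 expr0 mulr1 /coef expr0 fact0 divr1.
by rewrite expr0n mulr0.
Qed.

(** The product has derivative 0 because [A] commutes with its exponential, so it keeps its value at
    0. *)
Lemma expmxN t : expmx t *m expmx (- t) = 1%:M.
Proof.
apply/matrixP => i j.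
have H (s : R) : is_derive s 1 (fun s => expmx s *m expmx (- s)) 0.
  have hN : is_derive s 1 (fun s => expmx (- s)) (- (A *m expmx (- s))).
    apply: is_derive_mx => k l; rewrite mxE -mulN1r mulrC.
    have hk := is_derive_mx_entry k l (is_derive_expmx (- s)).
    by apply: (@is_derive1_comp _ (fun s => expmx s k l) -%R).
  apply: is_derive_eq; first exact: is_derive_mulmx (is_derive_expmx s) hN.
  by rewrite mulmxN mulmxA -expmx_comm subrr.
have -> : (expmx t *m expmx (- t)) i j = (expmx 0 *m expmx (- 0)) i j.
  apply: (@is_derive_0_is_cst _ (fun s => (expmx s *m expmx (- s)) i j)) => s.
  by have := is_derive_mx_entry i j (H s); rewrite mxE.
by rewrite oppr0 expmx0 mulmx1.
Qed.

End matrix_exponential.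

(** * Square-integrable signals *)

Section square_integrable.
Context {R : realType}.
Notation mu := (@lebesgue_measure R).
Variable D : set R.
Hypothesis mD : measurable (D : set (measurableTypeR R)).
Implicit Types f g : R -> R.

(** A scalar notion, because matrix products and quadratic forms of signals expand into linear
    combinations and products of entries. *)
Definition sqint f := mfun D f /\ mu.-integrable D (EFin \o (fun t => f t ^+ 2)).

Lemma le_integrable_EFin f g : mfun D f -> (forall t, D t -> `|f t| <= g t) ->
  mu.-integrable D (EFin \o g) -> mu.-integrable D (EFin \o f).
Proof.
move=> mf fg; apply: le_integrable => //; first exact/measurable_EFinP.
by move=> t Dt; rewrite /= lee_fin (le_trans (fg t Dt))// ler_norm.
Qed.

Lemma integrableD_EFin f g : mu.-integrable D (EFin \o f) ->
  mu.-integrable D (EFin \o g) -> mu.-integrable D (EFin \o (fun t => f t + g t)).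
Proof. by move=> intf intg; exact: (integrableD mD intf intg). Qed.

Lemma integrable_sum_EFin (I : finType) (f : I -> R -> R) :
  (forall i, mu.-integrable D (EFin \o f i)) ->
  mu.-integrable D (EFin \o (fun t => \sum_i f i t)).
Proof.
move=> intf; rewrite (_ : EFin \o _ = fun t => \sum_i (EFin \o f i) t)%E.
  by apply: integrable_sum => // i _; exact: intf.
by apply/funext => t; rewrite /= sumEFin.
Qed.

Lemma sqint_prod f g : sqint f -> sqint g ->
  mu.-integrable D (EFin \o (fun t => f t * g t)).
Proof.
move=> [mf intf] [mg intg].
apply: (@le_integrable_EFin _ (fun t => f t ^+ 2 + g t ^+ 2)).
- exact: measurable_funM.
- move=> t _; rewrite normrM -[f t ^+ 2]real_normK ?num_real//.
  rewrite -[g t ^+ 2]real_normK ?num_real//.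
  by set x := `|f t|; set y := `|g t|; have : 0 <= x ^+ 2 + y ^+ 2 - x * y; nra.
- exact: integrableD_EFin.
Qed.

Lemma sqintD f g : sqint f -> sqint g -> sqint (fun t => f t + g t).
Proof.
move=> hf hg; have [[mf intf] [mg intg]] := (hf, hg).
split; first exact: measurable_funD.
have intfg := sqint_prod hf hg.
have := integrableD_EFin (integrableD_EFin intf intg) (integrableD_EFin intfg intfg).
by congr (mu.-integrable D (EFin \o _)); apply/funext => t; ring.
Qed.

Lemma sqintZ c f : sqint f -> sqint (fun t => c * f t).
Proof.
move=> [mf intf]; split.
  by apply: measurable_funM => //; exact: measurable_cst.
have := integrableZl mD (c ^+ 2) intf.
by congr (integrable _ _ _); apply/funext => t; rewrite /= -EFinM exprMn.
Qed.

Lemma sqint0 : sqint (fun=> 0).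
Proof.
split; first exact: measurable_cst.
rewrite (_ : EFin \o _ = cst 0%E); first exact: integrable0.
by apply/funext => t; rewrite /= expr0n.
Qed.

Lemma sqint_lincomb (I : finType) (c : I -> R) (f : I -> R -> R) :
  (forall i, sqint (f i)) -> sqint (fun t => \sum_i c i * f i t).
Proof.
move=> hf; elim: (index_enum I) => [|i r ih].
  by under eq_fun do rewrite big_nil; exact: sqint0.
by under eq_fun do rewrite big_cons; apply: sqintD => //; exact: sqintZ.
Qed.

Lemma sqint_mulmx m n (A : 'M[R]_(m, n)) (x : R -> 'cV[R]_n) :
  (forall j, sqint (fun t => x t j ord0)) ->
  forall i, sqint (fun t => (A *m x t) i ord0).
Proof.
by move=> hx i; under eq_fun do rewrite mxE; exact: sqint_lincomb.
Qed.

Lemma sqint_quad n (M : 'M[R]_n) (x : R -> 'cV[R]_n) :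
  (forall j, sqint (fun t => x t j ord0)) ->
  mu.-integrable D (EFin \o (fun t => quad M (x t))).
Proof.
move=> hx; under eq_fun do rewrite /quad -mulmxA mxE.
apply: integrable_sum_EFin => i; under eq_fun do rewrite mxE.
by apply: sqint_prod => //; exact: sqint_mulmx.
Qed.

Lemma sqnormE n (x : 'cV[R]_n) : sqnorm x = \sum_i x i ord0 ^+ 2.
Proof. by rewrite /sqnorm mxE; apply: eq_bigr => i _; rewrite mxE expr2. Qed.

Lemma sqnorm_ge0 n (x : 'cV[R]_n) : 0 <= sqnorm x.
Proof. by rewrite sqnormE sumr_ge0// => i _; rewrite sqr_ge0. Qed.

Lemma L2_integrable_sqnorm n (x : R -> 'cV[R]_n) : L2 D x ->
  mu.-integrable D (EFin \o (fun t => sqnorm (x t))).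
Proof.
move=> [mx xoo]; apply/integrableP; split.
  apply/measurable_EFinP; under eq_fun do rewrite sqnormE.
  by apply: measurable_sum => j; apply: measurable_funX; exact: mx.
under eq_integral => t _ do rewrite /= ger0_norm ?sqnorm_ge0//.
by apply: (lty_poweRy _ xoo); rewrite invr_neq0.
Qed.

Lemma L2_sqint n (x : R -> 'cV[R]_n) : L2 D x -> forall i, sqint (fun t => x t i ord0).
Proof.
move=> L2x i; have [mx _] := L2x; split; first exact: mx.
apply: le_integrable_EFin (L2_integrable_sqnorm L2x).
  by apply: measurable_funX; exact: mx.
move=> t _; rewrite ger0_norm ?sqr_ge0// sqnormE (bigD1 i)//= lerDl.
by apply: sumr_ge0 => j _; rewrite sqr_ge0.
Qed.

End square_integrable.

Lemma sqint_continuous (R : realType) (a b : R) (f : R -> R) :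
  {within `[a, b], continuous (f : R -> R^o)} -> sqint `[a, b] f.
Proof.
move=> cf; split; first exact: subspace_continuous_measurable_fun.
apply: continuous_compact_integrable; first exact: segment_compact.
by move=> t; exact: (cvgM (cf t) (cf t)).
Qed.

Lemma ac_on_within_continuous (R : realType) (V : normedModType R) (a b : R) (f : R -> V) :
  ac_on a b f -> {within `[a, b], continuous f}.
Proof.
move=> acf; apply/subspace_continuousP => t tab; apply/cvgrPdist_lt => eps eps0.
have [d d0 hd] := ac_on_continuous acf eps0.
near=> s; rewrite distrC; apply: hd; first by move: tab; rewrite /= in_itv.
  by have : `[a, b]%classic s; [near: s; exact: withinT|rewrite /= in_itv].
rewrite distrC; near: s; apply: cvg_within; near=> s; near: s.
by apply/nbhs_ballP; exists d.
Unshelve. all: by end_near. Qed.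

(** * Linear differential equations with integrable input *)

Lemma within_continuous_bounded (R : realType) (a b : R) (f : R -> R) :
  {within `[a, b], continuous (f : R -> R^o)} ->
  exists M : R, forall t, a <= t <= b -> `|f t| <= M.
Proof.
move=> cf; have cab := @segment_compact R a b.
have [M [_ hM]] := compact_bounded (continuous_compact cf cab).
exists (M + 1) => t tab; apply: (hM (M + 1)); first by rewrite ltrDl.
by exists t => //; rewrite /= in_itv.
Qed.

Lemma ac_on_derive_continuous (R : realType) (a b : R) (f df : R -> R) :
  (forall t : R, is_derive t 1 f (df t)) -> continuous df ->
  ac_on a b (f : R -> R^o).
Proof.
move=> hf cdf; have [M hM] := within_continuous_bounded (continuous_subspaceT (A := `[a, b]) cdf).
apply: (@ac_on_lip _ _ _ _ _ _ _ M _ (@ac_on_id _ a b)) => s t as_ st tb.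
have [|c] := MVT_segment st (fun c _ => hf c).
  apply: continuous_subspaceT => c; apply: differentiable_continuous.
  by apply/derivable1_diffP; case: (hf c).
rewrite in_itv/= => /andP[sc ct] ->; rewrite normrM ler_wpM2r// hM//.
by rewrite (le_trans as_)// (le_trans ct).
Qed.

Lemma ac_onM (R : realType) (a b : R) (f g : R -> R) :
  ac_on a b (f : R -> R^o) -> ac_on a b (g : R -> R^o) ->
  ac_on a b (fun t => f t * g t : R^o).
Proof.
move=> acf acg.
have [M hM] := within_continuous_bounded (ac_on_within_continuous acf).
have [N hN] := within_continuous_bounded (ac_on_within_continuous acg).
apply: (@ac_on_lip _ _ _ _ _ _ _ (M + N) _ (ac_on_pair acf acg)) => s t as_ st tb.
(* The usual splitting of the increment of a product; [M] and [N] bound the factors on the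
   segment. *)
rewrite (_ : _ - _ = f t * (g t - g s) + (f t - f s) * g s); last by ring.
have hMt : `|f t| <= M by apply: hM; lra.
have hNs : `|g s| <= N by apply: hN; lra.
rewrite (le_trans (ler_normD _ _))// [leRHS]mulrDl lerD// normrM.
  apply: ler_pM => //; first by rewrite prod_normE/= le_max lexx orbT.
by rewrite mulrC; apply: ler_pM => //; rewrite prod_normE/= le_max lexx.
Qed.

Lemma ae_on_forall (R : realType) (D : set R) (I : finType) (P : I -> R -> Prop) :
  (forall i, ae_on D (P i)) -> ae_on D (fun t => forall i, P i t).
Proof.
move=> hP.
suff : ae_on D (fun t => forall i, i \in enum I -> P i t).
  by apply: ae_onS => // t _ h i; apply: h; rewrite mem_enum.
elim: (enum I) => [|j r ih].
  exact: aeW.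
apply: ae_onS (ae_onI (hP j) ih) => // t _ [Pj Pr] i.
by rewrite in_cons => /predU1P[->|/Pr].
Qed.

Section linear_ode.
Context {R : realType} {n : nat}.
Notation mu := (@lebesgue_measure R).
Variables (T : R) (A : 'M[R]_n) (g : R -> 'cV[R]_n).
Hypothesis hg : forall i, sqint `[0, T] (fun t => g t i ord0).

(** The integrand of variation of constants, cut off outside [[0, T]] because [primitive] is studied
    for functions integrable on the whole line. *)
Let f (i : 'I_n) : R -> R := (fun s : R => (expmx A (- s) *m g s) i ord0) \_ `[0, T].

Let intf i : mu.-integrable setT (EFin \o f i).
Proof.
rewrite /f -restrict_EFin; apply/(integrable_mkcond _ _).1 => //.
rewrite (_ : (fun s => _) = fun s => \sum_j expmx A (- s) i j * g s j ord0); last first.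
  by apply/funext => s; rewrite mxE.
apply: integrable_sum_EFin => // j; apply: sqint_prod => //.
apply: sqint_continuous; apply: continuous_subspaceT => t.
have -> : (fun s => expmx A (- s) i j) = (fun s => expmx A s i j) \o -%R by [].
apply: continuous_comp; first exact: opp_continuous.
apply: differentiable_continuous; apply/derivable1_diffP.
by have [] := is_derive_mx_entry i j (is_derive_expmx A (- t)).
Qed.

Let y (t : R) : 'cV[R]_n := \col_i primitive (f i) t.

(** The solution is [exp(tA)] times the integral of [exp(-sA) g(s)] over [[0, t]]; in its
    derivative, [expmxN] reduces the term coming from the integral to [g t]. *)
Lemma linear_ode_solution : exists x : R -> 'cV[R]_n,
  x 0 = 0 /\ solves_ode T x (fun t => A *m x t + g t).
Proof.
exists (fun t => expmx A t *m y t); split; [|split].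
- rewrite expmx0 mul1mx; apply/colP => i; rewrite !mxE; exact: primitive0.
- suff : ac_on 0 T (fun t => expmx A t *m y t) by [].
  apply: ac_on_mx => i k; under eq_fun do rewrite mxE.
  apply: (@ac_on_sum _ R^o _ _ _ (fun j t => expmx A t i j * y t j k)) => j.
  apply: ac_onM; last first.
    by under eq_fun do rewrite ord1 mxE; exact: ac_on_primitive.
  apply: (@ac_on_derive_continuous _ _ _ _ (fun t => (A *m expmx A t) i j)) => [t|].
    exact: is_derive_mx_entry (is_derive_expmx A t).
  move=> t; apply: differentiable_continuous; apply/derivable1_diffP.
  have := is_derive_mulmx (is_derive_cst A t 1) (is_derive_expmx A t).
  by move=> /(is_derive_mx_entry i j)[].
- apply: ae_onS (ae_on_forall (fun i => is_derive_primitive (intf i) T)) => // t tT hy.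
  have dy : is_derive t 1 y (expmx A (- t) *m g t).
    apply: is_derive_mx => i j; under eq_fun do rewrite mxE.
    by rewrite ord1; have := hy i; rewrite /f patchE mem_set.
  apply: is_derive_eq; first exact: is_derive_mulmx (is_derive_expmx A t) dy.
  by rewrite mulmxA expmxN mul1mx mulmxA.
Qed.

End linear_ode.

(** * Composition with a C1 function *)

(** Mean value theorem for [W] along the segment from [q1] to [q2]; only the differentials at its
    points have to be bounded. *)
Lemma lipschitz_segment (R : realType) (E : normedModType R) (W : E -> R) (L : R)
    (q1 q2 : E) : (forall p, differentiable W p) ->
  (forall s : R, 0 <= s <= 1 -> forall e,
     `|'d W (q1 + s *: (q2 - q1)) e| <= L * `|e|) ->
  `|W q2 - W q1| <= L * `|q2 - q1|.
Proof.
move=> dW hL; pose l (s : R) := q1 + s *: (q2 - q1).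
have dl (s : R) : is_diff s l (fun h => h *: (q2 - q1)).
  have := is_diffD (is_diff_cst q1 s) (is_diff_scalel s (q2 - q1)).
  by rewrite add0r.
have dWl (s : R) : is_derive s 1 (W \o l) ('d W (l s) (q2 - q1)).
  have dc : differentiable (W \o l) s by apply: differentiable_comp => //.
  apply: DeriveDef; first exact: diff_derivable.
  by rewrite deriveE// diff_comp//= diff_val scale1r.
have [|s] := MVT_segment ler01 (fun s _ => dWl s).
  apply: continuous_subspaceT => s; apply: differentiable_continuous.
  by apply/derivable1_diffP; case: (dWl s).
rewrite /l /= !scale0r addr0 scale1r subrKC subr0 mulr1 in_itv/= => s01 ->.
exact: hL.
Qed.

Lemma normr_le_prod (R : realType) (U V : normedModType R) (u : U) (v : V) :
  (`|u| <= `|(u, v)|) * (`|v| <= `|(u, v)|).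
Proof. by split; rewrite prod_normE/= le_max lexx ?orbT. Qed.

Lemma mx_entry_le_norm (R : realType) (m n : nat) (x : 'M[R]_(m, n)) i j :
  `|x i j| <= `|x|.
Proof.
rewrite [leRHS]/Num.Def.normr/= mx_normrE.
exact: (le_bigmax _ (fun ij : 'I_m * 'I_n => `|x ij.1 ij.2|) (i, j)).
Qed.

(** The constant is explicit in the values on basis vectors, so for [phi] a differential it varies
    continuously with the base point. *)
Lemma linear_colvec_bound (R : realType) (n : nat) (phi : 'cV[R]_n -> R) :
  linear (phi : 'cV[R]_n -> R^o) -> forall x,
  `|phi x| <= (\sum_i `|phi (delta_mx i ord0)|) * `|x|.
Proof.
move=> lphi x.
have phi0 : phi 0 = 0.
  by have := lphi 1 0 0; rewrite !scale1r addr0 => /eqP; rewrite -subr_eq subrr => /eqP.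
have -> : phi x = \sum_i x i ord0 * phi (delta_mx i ord0).
  rewrite {1}(matrix_sum_delta x); under eq_bigr do rewrite big_ord1.
  elim: (index_enum _) => [|i r ih]; first by rewrite !big_nil.
  by rewrite !big_cons lphi ih.
rewrite (le_trans (ler_norm_sum _ _ _))// mulr_suml; apply: ler_sum => i _.
by rewrite normrM mulrC ler_wpM2l// mx_entry_le_norm.
Qed.

Section C1.
Context {R : realType} {n m : nat}.
Variable V : R -> 'cV[R]_n -> 'cV[R]_m -> R.
Hypothesis hV : C1 V.

Let E : normedModType R := (R * 'cV[R]_n * 'cV[R]_m)%type.
Let W : E -> R := fun p => V p.1.1 p.1.2 p.2.

Let dW p : differentiable W p. Proof. by case: hV. Qed.

(** [C1] gives continuity of the differential only in each fixed direction. Its values on a basis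
    form the continuous bound [N] of the operator norm, which stays below [N p + 1] on a ball around
    [p]. *)
Lemma C1_locally_lipschitz (p : E) : exists2 r : R, 0 < r & exists L : R,
  forall q1 q2, `|p - q1| < r -> `|p - q2| < r -> `|W q2 - W q1| <= L * `|q2 - q1|.
Proof.
pose dt q := 'd W q (1, 0, 0).
pose dx q i := 'd W q (0, delta_mx i ord0, 0).
pose du q j := 'd W q (0, 0, delta_mx j ord0).
pose N q := `|dt q| + \sum_i `|dx q i| + \sum_j `|du q j|.
have hN q e : `|'d W q e| <= N q * `|e|.
  case: e => [[a x] u].
  have -> : 'd W q (a, x, u) = a * dt q + 'd W q (0, x, 0) + 'd W q (0, 0, u).
    rewrite -[a * _]/(a *: _) -linearZ -!linearD; congr ('d W q _).
    by congr (_, _, _); rewrite /= ?scaler0 ?addr0 ?add0r// [_ *: _]mulr1.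
  have [hax hu] := normr_le_prod (a, x) u; have [ha hx] := normr_le_prod a x.
  rewrite !mulrDl (le_trans (ler_normD _ _))// lerD//.
    rewrite (le_trans (ler_normD _ _))// lerD//.
      by rewrite normrM mulrC ler_wpM2l// (le_trans ha).
    have lx : linear (fun x => 'd W q (0, x, 0) : R^o).
      move=> k y z; rewrite -linearP; congr ('d W q _).
      by congr (_, _, _); rewrite /= ?scaler0 ?addr0.
    apply: le_trans (linear_colvec_bound lx x) _.
    by rewrite ler_wpM2l ?sumr_ge0// (le_trans hx).
  have lu : linear (fun u => 'd W q (0, 0, u) : R^o).
    move=> k y z; rewrite -linearP; congr ('d W q _).
    by congr (_, _, _); rewrite /= ?scaler0 ?addr0.
  apply: le_trans (linear_colvec_bound lu u) _.
  by rewrite ler_wpM2l ?sumr_ge0.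
have cN : {for p, continuous N}.
  have cd e : {for p, continuous (fun q => `|'d W q e| : R)}.
    by apply: cvg_norm; case: hV => _ /(_ e); exact.
  apply: cvgD; [apply: cvgD; first exact: cd|]; apply: cvg_big => [|i _].
  - exact: add_continuous.
  - exact: cd.
  - exact: add_continuous.
  - exact: cd.
have /cvgrPdist_lt/(_ 1 ltr01)/nbhs_ballP[r /= r0 hr] := cN.
exists r => //; exists (N p + 1) => q1 q2 pq1 pq2.
apply: (lipschitz_segment dW) => s /andP[s0 s1] e.
apply: le_trans (hN _ _) _; rewrite ler_wpM2r//.
suff /hr : ball p r (q1 + s *: (q2 - q1)).
  by move=> /=; rewrite ltr_distlC => /andP[_ /ltW].
rewrite -ball_normE /ball_/=.
(* Convexity of the ball: the whole segment stays where [N] is controlled. *)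
have -> : p - (q1 + s *: (q2 - q1)) = (1 - s) *: (p - q1) + s *: (p - q2).
  rewrite scalerBl scale1r -addrA [- _ + _]addrC -scalerBr.
  have -> : p - q2 - (p - q1) = q1 - q2 by rewrite opprB addrC subrKA.
  by rewrite -[q1 - q2]opprB scalerN opprD addrA.
rewrite (le_lt_trans (ler_normD _ _))// !normrZ ger0_norm ?subr_ge0// [`|s|]ger0_norm//.
set x := `|_|; set y := `|_|; have xM : x <= Num.max x y by rewrite le_max lexx.
have yM : y <= Num.max x y by rewrite le_max lexx orbT.
have Mr : Num.max x y < r by rewrite gt_max pq1.
have s1' : 0 <= 1 - s by rewrite subr_ge0.
by have := ler_wpM2l s1' xM; have := ler_wpM2l s0 yM; lra.
Qed.

Lemma locally_ac_C1 (a b : R) (x : R -> 'cV[R]_n) (u : R -> 'cV[R]_m) :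
  ac_on a b x -> ac_on a b u -> forall s, a <= s <= b -> exists2 d : R, 0 < d &
    ac_on (Num.max a (s - d)) (Num.min b (s + d)) (fun t => V t (x t) (u t) : R^o).
Proof.
move=> acx acu s sab; pose y (t : R) : E := (t, x t, u t).
have acy : ac_on a b y by apply: ac_on_pair acu; apply: ac_on_pair acx; exact: ac_on_id.
have [r r0 [L hL]] := C1_locally_lipschitz (y s).
have [d d0 hd] := ac_on_continuous acy r0.
have d20 : 0 < d / 2 by rewrite divr_gt0.
(* Halving keeps the closed interval, endpoints included, at distance less than [d] from [s]. *)
exists (d / 2) => //.
have : ac_on (Num.max a (s - d / 2)) (Num.min b (s + d / 2)) y.
  by apply: ac_onS acy; rewrite ?le_max ?ge_min lexx.
apply: (ac_on_lip (L := L)) => p q; rewrite ge_max le_min.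
move=> /andP[ap sp] pq /andP[qb qs].
by apply: (hL (y p) (y q)); rewrite distrC; apply: hd => //; rewrite ?ltr_norml; lra.
Qed.

(** Hypothesis (i) is phrased with derivatives of slices of [V]. Each is the full differential along
    one factor, by the chain rule for the embedding of that factor, and linearity adds the three. *)
Lemma is_derive_C1_comp (x : R -> 'cV[R]_n) (u : R -> 'cV[R]_m)
    (dx : 'cV[R]_n) (du : 'cV[R]_m) (t : R) :
  is_derive t 1 x dx -> is_derive t 1 u du ->
  is_derive t 1 (fun s => V s (x s) (u s))
    (derive1 (fun s => V s (x t) (u t)) t + 'd (fun y => V t y (u t)) (x t) dx
     + 'd (fun y => V t (x t) y) (u t) du).
Proof.
move=> [dfx <-] [dfu <-].
have dcomp (U : normedModType R) (f df : U -> E) (p : U) :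
    is_diff p f df -> forall e, 'd (W \o f) p e = 'd W (f p) (df e).
  move=> hf e; have dfp : differentiable f p by [].
  by rewrite diff_comp//= diff_val.
have -> : derive1 (fun s => V s (x t) (u t)) t = 'd W (t, x t, u t) (1, 0, 0).
  have hf : is_diff t (fun s : R => (s, x t, u t) : E) (fun h => (h, 0, 0)).
    exact: is_diff_pair (is_diff_pair (is_diff_id _) (is_diff_cst _ _)) (is_diff_cst _ _).
  rewrite -(dcomp _ _ _ _ hf) derive1E'//.
  by apply: (@differentiable_comp _ _ _ _ (fun s : R => (s, x t, u t) : E) W).
have -> : 'd (fun y => V t y (u t)) (x t) ('D_1 x t) = 'd W (t, x t, u t) (0, 'D_1 x t, 0).
  have hf : is_diff (x t) (fun y => (t, y, u t) : E) (fun h => (0, h, 0)).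
    exact: is_diff_pair (is_diff_pair (is_diff_cst _ _) (is_diff_id _)) (is_diff_cst _ _).
  by rewrite -(dcomp _ _ _ _ hf).
have -> : 'd (fun y => V t (x t) y) (u t) ('D_1 u t) = 'd W (t, x t, u t) (0, 0, 'D_1 u t).
  have hf : is_diff (u t) (fun y => (t, x t, y) : E) (fun h => (0, 0, h)).
    exact: is_diff_pair (is_diff_pair (is_diff_cst _ _) (is_diff_cst _ _)) (is_diff_id _).
  by rewrite -(dcomp _ _ _ _ hf).
have diffx : differentiable x t by apply/derivable1_diffP.
have diffu : differentiable u t by apply/derivable1_diffP.
pose y (s : R) : E := (s, x s, u s).
have hy : is_diff t y (fun h => (h, 'd x t h, 'd u t h)).
  exact: is_diff_pair (is_diff_pair (is_diff_id _) (differentiableP diffx))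
    (differentiableP diffu).
have dWy : differentiable (W \o y) t by apply: differentiable_comp.
apply: DeriveDef; first exact: diff_derivable.
rewrite deriveE// (dcomp _ _ _ _ hy) -!linearD !deriveE//; congr ('d W _ _).
by congr (_, _, _); rewrite /= ?addr0 ?add0r.
Qed.

End C1.

(** * Invariance of the sublevel set *)

Lemma sqintS (R : realType) (D E : set R) (f : R -> R) :
  measurable (D : set (measurableTypeR R)) -> measurable (E : set (measurableTypeR R)) ->
  E `<=` D -> sqint D f -> sqint E f.
Proof.
move=> mD mE ED [mf intf]; split; first exact: measurable_funS mf.
exact: integrableS intf.
Qed.

Lemma zero_ext_L2 (R : realType) (m : nat) (T : R) (v : R -> 'cV[R]_m) :
  L2 `[0, T] v -> L2 half_line (zero_ext T v).
Proof.
move=> [mv voo]; split.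
  move=> i.
  rewrite (_ : (fun t => _) = (fun t => v t i ord0) \_ `[0, T]).
    apply: (@measurable_funS _ _ _ _ setT) => //.
    by apply/(measurable_restrictT _ _).1 => //; exact: mv.
  by apply/funext => t; rewrite /zero_ext /patch; case: ifP => _ //; rewrite mxE.
rewrite /l2norm; apply: poweR_lty.
have {}voo : (\int[@lebesgue_measure R]_(t in `[0%R, T]) (sqnorm (v t))%:E < +oo)%E.
  by apply: (lty_poweRy _ voo); rewrite invr_neq0.
apply: le_lt_trans voo; rewrite [leRHS]integral_mkcond [leLHS]integral_mkcond.
rewrite le_eqVlt; apply/orP; left; apply/eqP; apply: eq_integral => t _.
rewrite /zero_ext /patch; have [tT|tT] := boolP (t \in `[0, T]%classic); last first.
  by case: ifP => // _; rewrite sqnormE big1// => i _; rewrite mxE expr0n.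
by rewrite mem_set// /half_line; move: tT; rewrite inE /= !in_itv/= => /andP[->].
Qed.

Lemma ac_on_mx_entry (R : realType) (m n : nat) (a b : R) (x : R -> 'M[R]_(m, n)) i j :
  ac_on a b x -> ac_on a b (fun t => x t i j : R^o).
Proof.
apply: (ac_on_lip (L := 1)) => s t _ _ _; rewrite mul1r.
by have := mx_entry_le_norm (x t - x s) i j; rewrite !mxE.
Qed.

Lemma ac_on_col_mx (R : realType) (m n : nat) (a b : R) (x : R -> 'cV[R]_m) (y : R -> 'cV[R]_n) :
  ac_on a b x -> ac_on a b y -> ac_on a b (fun t => col_mx (x t) (y t)).
Proof.
move=> acx acy; apply: ac_on_mx => i j; case: (split_ordP i) => k ->.
  by under eq_fun do rewrite col_mxEu; exact: ac_on_mx_entry.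
by under eq_fun do rewrite col_mxEd; exact: ac_on_mx_entry.
Qed.

Lemma is_derive_col_mx (R : realType) (m n : nat) (x : R -> 'cV[R]_m)
    (y : R -> 'cV[R]_n) (dx : 'cV[R]_m) (dy : 'cV[R]_n) (t : R) :
  is_derive t 1 x dx -> is_derive t 1 y dy ->
  is_derive t 1 (fun t => col_mx (x t) (y t)) (col_mx dx dy).
Proof.
move=> hx hy; apply: is_derive_mx => i j; case: (split_ordP i) => k ->.
  by under eq_fun do rewrite col_mxEu; rewrite col_mxEu; exact: is_derive_mx_entry.
by under eq_fun do rewrite col_mxEd; rewrite col_mxEd; exact: is_derive_mx_entry.
Qed.

(** The strict inequality survives squaring; it is the margin [lo < hi] of the invariance
    argument. *)
Lemma sqnorm_integral_lt (R : realType) (n : nat) (T rad : R) (d : R -> 'cV[R]_n) :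
  0 < rad -> disturbance T rad d ->
  \int[@lebesgue_measure R]_(t in `[0, T]) sqnorm (d t) < rad ^+ 2.
Proof.
move=> rad0 [_]; rewrite /l2norm /Rintegral.
have I0 : (0 <= \int[@lebesgue_measure R]_(t in `[0%R, T]) (sqnorm (d t))%:E)%E.
  by apply: integral_ge0 => t _; rewrite lee_fin sqnorm_ge0.
rewrite poweR12_sqrt//; move: I0; case: (integral _ _ _) => [r| |]//=.
rewrite lte_fin lee_fin => r0 rlt.
by rewrite -(sqr_sqrtr r0) ltrXn2r// qualifE/= ?sqrtr_ge0// ltW.
Qed.

(* Being trapped below [hi] on [0, t] improves the bound at [t] to [lo < hi];
   continuity then forbids leaving the sublevel set. *)
Lemma sublevel_invariant (R : realType) (T lo hi : R) (f : R -> R) : 0 <= T -> lo < hi ->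
  (forall s, 0 <= s <= T -> exists2 d : R, 0 < d &
     ac_on (Num.max 0 (s - d)) (Num.min T (s + d)) (f : R -> R^o)) ->
  (forall t, 0 <= t <= T -> (forall s, 0 <= s <= t -> f s <= hi) -> f t <= lo) ->
  f 0 <= lo -> forall t, 0 <= t <= T -> f t <= hi.
Proof.
move=> T0 lohi locf improve f0.
apply: (segment_ind (Q := fun t => forall s, 0 <= s <= t -> f s <= hi) T0) => [s|s s0T].
  by rewrite -eq_le => /eqP <-; lra.
have [d d0 acf] := locf s s0T.
have eps0 : 0 < hi - lo by lra.
have [e e0 he] := ac_on_continuous acf eps0.
(* [u] and [p] are each within [e / 2] of [s], hence within [e] of each other; the bound [d] keeps
   both where absolute continuity is known. *)
exists (Num.min d (e / 2)) => [|u v]; first by rewrite lt_min d0 divr_gt0.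
rewrite !lt_min => /andP[u0 us] /andP[sv vT] /andP[usd use] /andP[vsd vse] Qu p.
move=> /andP[p0 pv]; have [pu|up] := leP p u; first by apply: Qu; rewrite p0.
have fu : f u <= lo by apply: improve => //; rewrite u0 (le_trans us)// (le_trans sv).
have := he u p; rewrite !ge_max !le_min.
have -> : `|p - u| < e by rewrite ltr_norml; lra.
move=> H; have : `|f p - f u| < hi - lo by apply: H => //; lra.
by rewrite ltr_norml; lra.
Qed.

(** The IQC quantifies over filter trajectories, so one has to be exhibited before it can be
    used. *)
Lemma filter_state_exists (R : realType) (nv nw npsi nz : nat) (T : R)
    (Psi : filter_lti R nv nw npsi nz) (v : R -> 'cV[R]_nv) (w : R -> 'cV[R]_nw) :
  (forall i, sqint `[0, T] (fun t => v t i ord0)) ->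
  (forall i, sqint `[0, T] (fun t => w t i ord0)) ->
  exists xpsi, filter_state T Psi v w xpsi.
Proof.
move=> hv hw.
have hg i : sqint `[0, T] (fun t => (fB1 Psi *m v t + fB2 Psi *m w t) i ord0).
  rewrite (_ : (fun t => _) =
      fun t => (fB1 Psi *m v t) i ord0 + (fB2 Psi *m w t) i ord0).
    by apply: sqintD => //; exact: sqint_mulmx.
  by apply/funext => t; rewrite mxE.
have [x [x0 [acx dx]]] := linear_ode_solution (fA Psi) hg.
exists x; split => //; split => //.
by apply: ae_onS dx => // t _; rewrite addrA.
Qed.

Theorem theorem2 (R : realType) (nG nu nd nv nw npsi nz np : nat)
    (G : system R nG nu nd nv nw)
    (Delta : (R -> 'cV[R]_nv) -> (R -> 'cV[R]_nw))
    (hDelta : bounded_causal Delta)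
    (T rad gamma : R) (hT : 0 < T) (hrad : 0 < rad)
    (XT : set 'cV[R]_nG) (P : 'M[R]_(np, nu)) (b : 'cV[R]_np)
    (Psi : filter_lti R nv nw npsi nz) (hPsi : stable_filter Psi)
    (M : 'M[R]_nz) (hM : M^T = M)
    (hIQC : hard_IQC T Delta Psi M)
    (V : R -> 'cV[R]_(nG + npsi) -> 'cV[R]_nu -> R) (hV : C1 V)
    (kt : R -> 'cV[R]_nG -> 'cV[R]_nu -> 'cV[R]_nu)
    (h1 : forall t x xt w d, 0 <= t <= T -> V t x xt <= gamma + rad ^+ 2 ->
       derive1 (fun s => V s x xt) t
       + 'd (fun y => V t y xt) x (ext_F G Psi x w d xt)
       + 'd (fun y => V t x y) xt (kt t (usubmx x) xt)
       + quad M (ext_H G Psi x w d xt) <= sqnorm d)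
    (h2 : forall xpsi xt, polytope P b xt ->
       [set xG | V T (col_mx xG xpsi) xt <= gamma + rad ^+ 2] `<=` XT)
    (h3 : forall i t x xt, 0 <= t <= T -> V t x xt <= gamma + rad ^+ 2 ->
       (row i P *m xt) ord0 ord0 <= b i ord0) :
  forall xi : 'cV[R]_nG, V 0 (col_mx xi 0) 0 <= gamma ->
    (forall d xG (xt : R -> 'cV[R]_nu) v w,
       disturbance T rad d ->
       closed_loop T G Delta (integral_controller kt) xi d xG xt v w ->
       (forall t, 0 <= t <= T -> polytope P b (xt t)) /\ XT (xG T)) /\
    (closed_loop_exists T rad G Delta (integral_controller kt) xi ->
       BRS T XT (polytope P b) rad G Delta xi).
Proof.
move=> xi V0.
have steered : forall d xG (xt : R -> 'cV[R]_nu) v w, disturbance T rad d ->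
    closed_loop T G Delta (integral_controller kt) xi d xG xt v w ->
    (forall t, 0 <= t <= T -> polytope P b (xt t)) /\ XT (xG T); last first.
  by split=> [//|ex]; exists (integral_controller kt).
move=> d xG xt v w hd [/= xt0 [acxt dxt] [xG0 [acxG dxG] [L2v L2w] hv hw]].
(* On [[0, T]], [ve] equals [v] everywhere and [we] equals [w] almost everywhere, so the filter
   driven by [(ve, we)] serves for the closed loop while the IQC applies to it directly. *)
pose ve := zero_ext T v; pose we := Delta ve.
have L2ve : L2 half_line ve by exact: zero_ext_L2.
have L2we : L2 half_line we by case: hDelta => h _ _; exact: h.
have sub0T : `[0, T] `<=` @half_line R.
  by move=> t; rewrite /half_line /= !in_itv/= => /andP[->].
have mhl : measurable (half_line : set (measurableTypeR R)) by exact: measurable_itv.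
have sqve i : sqint `[0, T] (fun t => ve t i ord0).
  exact: sqintS mhl (measurable_itv _) sub0T (L2_sqint mhl L2ve i).
have sqwe i : sqint `[0, T] (fun t => we t i ord0).
  exact: sqintS mhl (measurable_itv _) sub0T (L2_sqint mhl L2we i).
have [xpsi fxpsi] := filter_state_exists Psi sqve sqwe.
have iqc := hIQC _ L2ve _ fxpsi.
have [xpsi0 [acxpsi dxpsi]] := fxpsi.
pose z t := filter_output Psi (xpsi t) (ve t) (we t).
have sqz i : sqint `[0, T] (fun t => z t i ord0).
  rewrite (_ : (fun t => _) = fun t => (fC Psi *m xpsi t) i ord0 +
      (fD1 Psi *m ve t) i ord0 + (fD2 Psi *m we t) i ord0).
    apply: sqintD => //; last exact: sqint_mulmx.
    apply: sqintD => //; apply: sqint_mulmx => // j.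
    by apply: sqint_continuous; apply: ac_on_within_continuous; exact: ac_on_mx_entry.
  by apply/funext => t; rewrite !mxE.
have intd : (@lebesgue_measure R).-integrable `[0, T] (EFin \o (fun t => sqnorm (d t))).
  by apply: L2_integrable_sqnorm => //; case: hd.
have intz := sqint_quad (measurable_itv _) M sqz.
pose phi t := sqnorm (d t) - quad M (z t).
have intphi : (@lebesgue_measure R).-integrable `[0, T] (EFin \o phi).
  exact: (integrableB _ intd intz).
have intphi0 : (@lebesgue_measure R).-integrable setT (EFin \o (phi \_ `[0, T])).
  by rewrite -restrict_EFin; apply/(integrable_mkcond _ _).1.
pose Phi := primitive (phi \_ `[0, T]).
pose X t := col_mx (xG t) (xpsi t).
have acX : ac_on 0 T X by exact: ac_on_col_mx.
pose W t := V t (X t) (xt t).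
have locW := locally_ac_C1 hV acX acxt.
pose c := \int[@lebesgue_measure R]_(t in `[0, T]) sqnorm (d t).
have c_lt : c < rad ^+ 2 by exact: sqnorm_integral_lt.
(* The IQC at time [t] removes the quadratic term; what remains is the energy of [d] up to [t], at
   most its energy up to [T]. *)
have Phi_le (t : R) : 0 <= t <= T -> Phi t <= c.
  move=> /andP[t0 tT].
  have sub : `[0, t] `<=` `[0, T] by apply: subset_itvl; rewrite bnd_simp.
  have -> : Phi t = \int[@lebesgue_measure R]_(s in `[0, t]) (sqnorm (d s) - quad M (z s)).
    by apply: eq_Rintegral => s /set_mem /sub sT; rewrite /patch mem_set.
  rewrite RintegralB//; [|exact: integrableS intd|exact: integrableS intz].
  have q0 : 0 <= \int[@lebesgue_measure R]_(s in `[0, t]) quad M (z s).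
    by apply: fine_ge0; apply: iqc; rewrite t0.
  rewrite (le_trans (_ : _ <= \int[@lebesgue_measure R]_(s in `[0, t]) sqnorm (d s)))//.
    by rewrite gerBl.
  rewrite /c /Rintegral fine_le//.
  - by apply: integrable_fin_num => //; exact: integrableS intd.
  - exact: integrable_fin_num.
  - apply: ge0_subset_integral => //; first by case/integrableP: intd.
    by move=> s _; rewrite lee_fin sqnorm_ge0.
have W0 : W 0 <= gamma by rewrite /W /X xG0 xpsi0 xt0.
have improve (t : R) : 0 <= t <= T -> (forall s, 0 <= s <= t -> W s <= gamma + rad ^+ 2) ->
    W t <= gamma + c.
  move=> t0T Wle; have /andP[t0 tT] := t0T.
  suff : W t - Phi t <= W 0 - Phi 0.
    have -> : Phi 0 = 0 by exact: primitive0.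
    by rewrite subr0 lerBlDr => /le_trans; apply; rewrite lerD// Phi_le.
  apply: (locally_ac_derive_le0 (f := fun s => W s - Phi s) t0) => [s /andP[s0 st]|].
    have [|r r0 acW] := locW s; first by rewrite s0 (le_trans st).
    exists r => //; apply: ac_onD.
      by apply: ac_onS acW; rewrite // le_min !ge_min tT lexx orbT.
    apply: ac_onN; apply: ac_onS (ac_on_primitive intphi0 T).
      by rewrite le_max lexx.
    by rewrite ge_min tT.
  have sub : `[0, t] `<=` `[0, T] by apply: subset_itvl; rewrite bnd_simp.
  have := ae_onI (ae_onI dxG dxpsi) (ae_onI dxt (ae_onI (ae_onI hv hw)
    (is_derive_primitive intphi0 T))).
  apply: ae_onS => // s st [[dxGs dxpsis] [dxts [[vs ws] dPhi]]].
  have sT := sub _ st.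
  have ves : ve s = v s by rewrite /ve /zero_ext /patch mem_set.
  have dX := is_derive_col_mx dxGs dxpsis.
  have dW := is_derive_C1_comp hV dX dxts.
  eexists; first exact: is_deriveB dW dPhi.
  (* The identities for [ve s], [we s] and [v s] at this time turn the integrand of [Phi] into the
     terms of (i). *)
  have := h1 s (X s) (xt s) (w s) (d s).
  rewrite /ext_F /ext_H /X !col_mxKu !col_mxKd => H.
  have wes : we s = w s by rewrite ws.
  rewrite subr_le0 /patch mem_set// /phi lerBrDr /z wes ves vs; apply: H.
    by move: sT; rewrite /= in_itv.
  by apply: Wle; move: st; rewrite /= in_itv/=.
have Wle t : 0 <= t <= T -> W t <= gamma + rad ^+ 2.
  apply: (sublevel_invariant (ltW hT) _ locW improve); first by rewrite ltrD2l.
  rewrite (le_trans W0)// lerDl /c /Rintegral fine_ge0//.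
  by apply: integral_ge0 => s _; rewrite lee_fin sqnorm_ge0.
have pol t : 0 <= t <= T -> polytope P b (xt t).
  by move=> t0T i; have := h3 i t (X t) (xt t) t0T (Wle t t0T); rewrite -row_mul mxE.
(* The terminal inclusion (ii) is available only for commands in the polytope, so [pol] is used at
   [T] as well. *)
split=> //; apply: (h2 (xpsi T) (xt T)); last by apply: Wle; rewrite lexx ltW.
by apply: pol; rewrite lexx ltW.
Qed.
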